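(* Let $m$ be a positive integer, let $G$ be an $m$-boundedly generated group, and let $L \leq G$ be a finite index subgroup. Then there exists a subgroup $U \leq L$ such that $d(U) \leq m$ and $[G : U] \leq \mathrm{exp}(G,L)^m$.
   Context: For a positive integer $m$, a group $G$ is called $m$-boundedly generated if there exist $g_1, \dots, g_m \in G$ such that $G = \langle g_1 \rangle \cdots \langle g_m \rangle$ as sets, i.e. every element of $G$ can be written as $g_1^{a_1} \cdots g_m^{a_m}$ for some integers $a_1, \dots, a_m$. For a group $U$, $d(U)$ denotes the smallest cardinality of a generating set of $U$. For a group $G$ and a subgroup $L \leq G$, $\mathrm{exp}(G,L)$ denotes the least positive integer $n$ such that $a^n \in L$ for every $a \in G$ (and $\mathrm{exp}(G,L) = \infty$ if no such integer exists; it is finite whenever $[G:L]$ is finite). *)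

(* Defs.v *)
From mathcomp Require Import all_boot all_order all_algebra.
From mathcomp Require Import all_classical.
From mathcomp Require Import constructive_ereal.

Set Implicit Arguments.
Unset Strict Implicit.
Unset Printing Implicit Defensive.

Local Open Scope classical_set_scope.
Local Open Scope group_scope.

(* The least element of P, and +oo when P is empty. The values are in
   \bar int because the order and product of \bar R need a numDomainType R. *)
Definition least (P : set nat) : \bar int :=
  match pselect (exists n, n \in P) with
  | left exP => (Posz (ex_minn exP))%:E%E
  | right _ => +oo%E
  end.

(* Finite cardinalities are recorded exactly; every infinite one becomes +oo. *)
Definition ecard (T : Type) (A : set T) : \bar int :=
  least [set n | (A #= `I_n)%card].

Section Groups.
Variable G : groupType.

Definition expgz (x : G) (a : int) : G :=
  match a with
  | Posz n => x ^+ n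
  | Negz n => x ^- n.+1
  end.

Definition boundedly_generated (m : nat) : Prop :=
  exists g : 'I_m -> G, forall x : G,
    exists a : 'I_m -> int, x = \prod_(i < m) expgz (g i) (a i).

Definition subgroup (A : set G) : Prop := group_closed [in A].

Definition gen_subgroup (S : set G) : set G := smallest subgroup S.

Definition gen_rank (U : set G) : \bar int :=
  least [set n | exists2 S : set G, (S #= `I_n)%card & gen_subgroup S = U].

Definition left_cosets (U : set G) : set (set G) :=
  range (fun x : G => [set x * u | u in U]).

Definition sg_index (U : set G) : \bar int := ecard (left_cosets U).

Definition sg_exponent (L : set G) : \bar int :=
  least [set n | (0 < n)%N /\ forall a : G, L (a ^+ n)].

End Groups.

Arguments boundedly_generated : clear implicits.

(* Main.v *)
(* Let e be the exponent of L. Writing a_i = q_i e + r_i with 0 <= r_i < e and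
   moving all the g_i ^ r_i to the left of the product of the g_i ^ a_i, each
   element of G lies in a coset x_r U_r, where r = (r_1, ..., r_m), x_r is the
   product of the g_i ^ r_i, and U_r is generated by m conjugates of the
   g_i ^ e. Each U_r is contained in L, because a conjugate of an e-th power is
   an e-th power. So G is the union of e ^ m cosets of subgroups of L with m
   generators, and by B. H. Neumann's lemma one of these subgroups has index at
   most e ^ m. *)
Require Import Defs.
From mathcomp Require Import all_boot all_order all_algebra.
From mathcomp Require Import all_classical.
From mathcomp Require Import constructive_ereal.

Local Open Scope classical_set_scope.
Local Open Scope group_scope.

Section Cosets.
Context {G : groupType}.
Implicit Types (A H K S U : set G) (x y z : G) (s : seq G).

(** * Closure properties of subgroups *)

Lemma subgroupP A :
  subgroup A <-> A 1 /\ forall x y, A x -> A y -> A (x * y^-1).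
Proof.
split=> [[A1 AB]|[A1 AB]].
  split=> [|x y Ax Ay]; first exact: set_mem A1.
  by apply/set_mem/AB; apply/mem_set.
split=> [|x y /set_mem Ax /set_mem Ay]; first exact: mem_set.
exact/mem_set/AB.
Qed.

Lemma subgroup1 A : subgroup A -> A 1.
Proof. by move=> /subgroupP[]. Qed.

Lemma subgroupV A x : subgroup A -> A x -> A x^-1.
Proof.
by move=> /subgroupP[A1 AB] Ax; rewrite -[x^-1]mul1g; apply: AB.
Qed.

Lemma subgroupM A x y : subgroup A -> A x -> A y -> A (x * y).
Proof.
move=> sgA Ax Ay; rewrite -[y]invgK.
by apply: (proj2 (iffLR (subgroupP A) sgA)) => //; apply: subgroupV.
Qed.

Lemma subgroupX A x n : subgroup A -> A x -> A (x ^+ n).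
Proof.
move=> sgA Ax; elim: n => [|n IHn]; first by rewrite expg0; apply: subgroup1.
by rewrite expgS; apply: subgroupM.
Qed.

Lemma subgroup_prod A m (u : 'I_m -> G) :
  subgroup A -> (forall i, A (u i)) -> A (\prod_(i < m) u i).
Proof.
move=> sgA Au; apply: (big_ind A) => // [|x y Ax Ay]; first exact: subgroup1.
exact: subgroupM.
Qed.

Lemma subgroup_preim_conj A t : subgroup A -> subgroup [set h | A (h ^ t)].
Proof.
move=> sgA; apply/subgroupP; split=> /= [|x y Ax Ay].
  by rewrite conj1g; apply: subgroup1.
by rewrite conjMg conjVg; apply: subgroupM => //; apply: subgroupV.
Qed.

Lemma gen_subgroupP S : subgroup (gen_subgroup S).
Proof.
apply/subgroupP; split=> [B [sgB _]|x y Sx Sy B [sgB SB]]; first exact: subgroup1.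
by apply: subgroupM => //; [apply: Sx | apply: subgroupV => //; apply: Sy].
Qed.

(** * Left cosets, finite index and transversals *)

Lemma subgroup_translate A x y z :
  subgroup A -> A (x^-1 * y) -> A (x^-1 * z) -> A (y^-1 * z).
Proof.
move=> sgA Axy Axz.
have -> : y^-1 * z = (x^-1 * y)^-1 * (x^-1 * z) by rewrite invgM invgK mulgA mulgK.
by apply: subgroupM => //; apply: subgroupV.
Qed.

(** The list may repeat cosets, so its length is only an upper bound for the index. *)
Definition coset_cover H s := forall x, exists2 y, y \in s & H (y^-1 * x).

Definition finite_index H := exists s, coset_cover H s.

Lemma finite_indexT : finite_index setT.
Proof. by exists [:: 1] => x; exists 1; rewrite ?mem_head. Qed.

Lemma finite_indexI H K : subgroup H -> subgroup K ->
  finite_index H -> finite_index K -> finite_index (H `&` K).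
Proof.
move=> sgH sgK [s Hs] [t Kt].
(* A nonempty intersection of [y H] and [z K] is a coset of [H] meet [K], and [w y z] is a point of
   it; the default 1 occurs only for empty intersections. *)
pose w y z := xget 1 [set x | H (y^-1 * x) /\ K (z^-1 * x)].
exists [seq w y z | y <- s, z <- t] => x.
have [y ys Hyx] := Hs x; have [z zt Kzx] := Kt x.
exists (w y z); first exact: allpairs_f.
have [Hw Kw] : H (y^-1 * w y z) /\ K (z^-1 * w y z).
  by apply: (@xgetPex _ 1 [set x | H (y^-1 * x) /\ K (z^-1 * x)]); exists x.
by split; [apply: subgroup_translate Hw Hyx | apply: subgroup_translate Kw Kzx].
Qed.

Lemma subgroup_bigcap (I : eqType) (H : I -> set G) (J : seq I) :
  (forall i, subgroup (H i)) -> subgroup [set x | forall i, i \in J -> H i x].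
Proof.
move=> sgH; apply/subgroupP; split=> /= [i _|x y Hx Hy i iJ]; first exact: subgroup1.
by apply: subgroupM => //; [apply: Hx | apply: subgroupV => //; apply: Hy].
Qed.

Lemma finite_index_bigcap (I : eqType) (H : I -> set G) (J : seq I) :
  (forall i, subgroup (H i)) -> (forall i, i \in J -> finite_index (H i)) ->
  finite_index [set x | forall i, i \in J -> H i x].
Proof.
move=> sgH; elim: J => [|j J IHJ] finH.
  rewrite (_ : [set x | _] = setT); first exact: finite_indexT.
  by apply/seteqP; split.
rewrite (_ : [set x | _] = H j `&` [set x | forall i, i \in J -> H i x]); last first.
  apply/seteqP; split=> x /=.
    by move=> Hx; split=> [|i iJ]; apply: Hx; rewrite inE ?eqxx ?iJ ?orbT.
  by move=> [Hj HJ] i; rewrite inE => /predU1P[->|/HJ].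
apply: finite_indexI => //; first exact: subgroup_bigcap.
- by apply: finH; rewrite mem_head.
- by apply: IHJ => i iJ; apply: finH; rewrite inE iJ orbT.
Qed.

Lemma transversal K : subgroup K -> finite_index K ->
  exists (r : G -> G) (T : seq G),
    [/\ uniq T, forall x, r x \in T, {in T, forall t, r t = t}
      & forall x y, r x = r y <-> K (x^-1 * y)].
Proof.
move=> sgK [s Ks]; pose P x t := `[< K (x^-1 * t) >].
(* The first element of [s] in [x K] depends only on the coset, which makes [r] canonical. It exists
   by [hasP], so the default 1 is never reached. *)
pose r x := nth 1 s (find (P x) s).
have hasP x : has (P x) s.
  have [y ys Kyx] := Ks x; apply/hasP; exists y => //; apply/asboolP.
  by rewrite -[x^-1 * y]invgK invgM invgK; apply: subgroupV.
have Kr x : K (x^-1 * r x) by apply/asboolP/(nth_find 1 (hasP x)).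
have rK x y : r x = r y <-> K (x^-1 * y).
  split=> [rxy|Kxy].
    have := Kr x; rewrite rxy => Kxr.
    have -> : x^-1 * y = (x^-1 * r y) * (y^-1 * r y)^-1.
      by rewrite invgM invgK mulgA mulgK.
    by apply: subgroupM => //; apply: subgroupV.
  rewrite /r (@eq_find _ (P x) (P y)) // => t; apply/asboolP/asboolP => Kt.
    exact: subgroup_translate Kxy Kt.
  by rewrite -(mulgK y x^-1) -mulgA; apply: subgroupM.
have rr x : r (r x) = r x by apply/esym/rK.
exists r, (undup (map r s)); split=> //; first exact: undup_uniq.
  move=> x; rewrite mem_undup -rr; apply/map_f.
  by apply: mem_nth; rewrite -has_find.
by move=> t; rewrite mem_undup => /mapP[x _ ->].
Qed.

(** * Neumann's covering lemma *)

Lemma separated_points H N : subgroup H ->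
  (forall s, (size s <= N)%N -> ~ coset_cover H s) ->
  exists y : 'I_N.+1 -> G, forall j k, H ((y j)^-1 * y k) -> j = k.
Proof.
move=> sgH noH.
suff /(_ N.+1 (leqnn _))[y yP] : forall n, (n <= N.+1)%N ->
    exists y : nat -> G, forall j k, (j < n)%N -> (k < n)%N ->
      H ((y j)^-1 * y k) -> j = k.
  by exists y => j k /yP e; apply/val_inj/e.
elim=> [_|n IHn ltnN]; first by exists (fun=> 1).
have [y yP] := IHn (ltnW ltnN).
(* Greedy choice: the at most [N] cosets found so far do not cover the group, so a new point lies
   outside them. *)
have /noH/existsNP[x xP] : (size (mkseq y n) <= N)%N by rewrite size_mkseq.
have Hx j : (j < n)%N -> ~ H ((y j)^-1 * x).
  by move=> ltjn Hj; apply: xP; exists (y j); rewrite // map_f // mem_iota.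
have lt_n j : (j < n.+1)%N -> j != n -> (j < n)%N.
  by rewrite ltnS leq_eqVlt => /orP[/eqP->|//]; rewrite eqxx.
exists (fun j => if j == n then x else y j) => j k /lt_n ltjn /lt_n ltkn.
case: eqVneq ltjn => [->|_] ltjn; case: eqVneq ltkn => [->|_] ltkn //.
- move=> /(subgroupV _ _ sgH); rewrite invgM invgK => Hk.
  by have [] := Hx k (ltkn isT).
- by move=> Hj; have [] := Hx j (ltjn isT).
exact: yP (ltjn isT) (ltkn isT).
Qed.

(* If a coset of the first subgroup is missing from the cover, then it is
   covered by the cosets of the other subgroups, and hence, after translation,
   so is every coset of the first subgroup, which can thus be discarded. *)
Lemma cover_finite_index (I : eqType) (H : I -> set G) (J : seq I)
    (s : I -> seq G) :
  (forall i, subgroup (H i)) ->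
  (forall x, exists2 i, i \in J & exists2 y, y \in s i & H i (y^-1 * x)) ->
  exists2 i, i \in J & finite_index (H i).
Proof.
move=> sgH; elim: J s => [|j J IHJ] s Hs; first by have [] := Hs 1.
have [finj|infj] := pselect (finite_index (H j)).
  by exists j; rewrite ?mem_head.
have /existsNP[a aP] : ~ coset_cover (H j) (s j) by move=> Hj; apply: infj; exists (s j).
(* Left translation by [y * a^-1] carries the coset of the uncovered point [a] onto that of [y]. *)
pose s' i := s i ++ [seq y * a^-1 * z | y <- s j, z <- s i].
have [|i iJ finHi] := IHJ s'; last by exists i; rewrite // inE iJ orbT.
have coverJ x : ~ (exists2 y, y \in s j & H j (y^-1 * x)) ->
    exists2 i, i \in J & exists2 y, y \in s i & H i (y^-1 * x).
  by move=> nj; have [i] := Hs x; rewrite inE => /predU1P[->|iJ] //; exists i.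
move=> x; have [[y yj Hyx]|] := pselect (exists2 y, y \in s j & H j (y^-1 * x)).
  have [|i iJ [z zi Hz]] := coverJ (a * (y^-1 * x)).
    move=> [z zj Hz]; apply: aP; exists z => //.
    rewrite -[a](mulgK (y^-1 * x)) mulgA.
    by apply: subgroupM => //; apply: subgroupV.
  exists i => //; exists (y * a^-1 * z).
    by rewrite mem_cat; apply/orP; right; apply: allpairs_f.
  by rewrite !invgM invgK -!mulgA.
by move=> /coverJ[i iJ [y yi Hy]]; exists i => //; exists y; rewrite // mem_cat yi.
Qed.

(** Union bound: densities at most 1 / n add up to at most [size J] / n, with denominators
    cleared. *)
Lemma leq_mul_count_has (I : eqType) (J : seq I) (T : eqType) (P : I -> pred T)
    (t : seq T) n :
  (forall i, i \in J -> (n * count (P i) t <= size t)%N) ->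
  (n * count (fun a => has (P^~ a) J) t <= size J * size t)%N.
Proof.
elim: J => [|j J IHJ] leP; first by rewrite count_pred0 muln0.
have /IHJ leJ : forall i, i \in J -> (n * count (P i) t <= size t)%N.
  by move=> i iJ; apply: leP; rewrite inE iJ orbT.
rewrite /= mulSn; apply: leq_trans (leq_add (leP j (mem_head _ _)) leJ).
rewrite -mulnDr leq_mul2l -count_predUI; apply/orP; right.
exact: leq_addr.
Qed.

(* B. H. Neumann's covering lemma. The cosets of infinite index can be ignored:
   what the others leave uncovered is a union of cosets of the intersection K
   of the finite-index subgroups. Modulo K, each remaining coset has density at
   most 1 / (#|I| + 1), so that together they cannot cover the group. *)
Lemma cover_small_index (I : finType) (H : I -> set G) (x : I -> G) :
  (forall i, subgroup (H i)) ->
  (forall z, exists i, H i ((x i)^-1 * z)) ->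
  exists i, exists2 s, (size s <= #|I|)%N & coset_cover (H i) s.
Proof.
move=> sgH Hx; apply: contrapT => noH; set N := #|I| in noH.
pose F := [seq i <- enum I | `[< finite_index (H i) >]].
pose K := [set z | forall i, i \in F -> H i z].
have sgK : subgroup K by apply: subgroup_bigcap.
have finK : finite_index K.
  by apply: finite_index_bigcap => // i; rewrite mem_filter => /andP[/asboolP].
have [r [T [uT rT rid rK]]] := transversal K sgK finK.
pose P i t := `[< H i ((x i)^-1 * t) >].
have leP i : i \in F -> (N.+1 * count (P i) T <= size T)%N.
  move=> iF; have [|y ysep] := separated_points (H i) N (sgH i).
    by move=> s sN Hs; apply: noH; exists i, s.
  (* Translation moves [t] from [x i H_i] into [y j H_i], and the representative modulo [K] stays
     there because [K] lies in [H i]. So [f] sends [N.+1] copies of the part of [T] in [x i H_i]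
     injectively into [T]. *)
  pose f (j : 'I_N.+1) t := r (y j * (x i)^-1 * t).
  have Hf j t : t \in [seq t <- T | P i t] -> H i ((y j)^-1 * f j t).
    rewrite mem_filter => /andP[/asboolP Ht tT].
    have /(_ i iF) Kf : K ((y j * (x i)^-1 * t)^-1 * f j t).
      by apply/rK/esym; apply: rid; apply: rT.
    rewrite -(mulVKg (y j * (x i)^-1 * t) (f j t)) !mulgA mulVg mul1g.
    by rewrite -mulgA; apply: subgroupM.
  rewrite -size_filter -[N.+1]size_enum_ord -(size_allpairs f).
  apply: uniq_leq_size => [|_ /allpairsP[p [_ _ ->]]]; last exact: rT.
  apply: allpairs_uniq; [exact: enum_uniq | exact: filter_uniq |].
  move=> [j t] [j' t'] /allpairsP[[j1 t1] [_ tP [-> ->]]].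
  move=> /allpairsP[[j2 t2] [_ tP' [-> ->]]] /= eqf; rewrite /= in tP tP'.
  have ej : j1 = j2.
    apply: ysep; have := Hf j2 _ tP'; rewrite -eqf => H2.
    have H1 := Hf j1 _ tP.
    have -> : (y j1)^-1 * y j2 = ((y j1)^-1 * f j1 t1) * ((y j2)^-1 * f j1 t1)^-1.
      by rewrite invgM invgK mulgA mulgK.
    by apply: subgroupM => //; apply: subgroupV.
  subst j2; congr (_, _); move: tP tP'; rewrite !mem_filter.
  move=> /andP[_ tT] /andP[_ tT']; rewrite -(rid _ tT) -(rid _ tT').
  apply/rK; move/rK: eqf.
  by rewrite invgM -mulgA mulKg.
(* If all of [T] were covered, the union bound would give [N.+1 <= size F], since [T] is nonempty;
   but [size F <= N]. *)
have [/allP allT|] := boolP (all (fun t => has (P^~ t) F) T).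
  have := leq_mul_count_has _ F _ P T N.+1 leP.
  have -> : count (fun t => has (P^~ t) F) T = size T.
    by apply/eqP; rewrite -all_count; apply/allP.
  rewrite leq_pmul2r; last by case: (T) (rT 1).
  by rewrite leqNgt ltnS /F size_filter (leq_trans (count_size _ _)) // -cardE.
(* As [K] lies in each [H i] with [i] in [F], all of [t K] is left to the subgroups of infinite
   index. Translates by [k * t^-1] then cover the group by finitely many of their cosets, which is
   impossible. *)
move=> /allPn[t tT /hasPn nP]; have [s sK] := finK.
pose J := [seq i <- enum I | i \notin F].
have [|i] := cover_finite_index _ H J (fun i => [seq k * t^-1 * x i | k <- s]) sgH.
  move=> z; have [k ks Kz] := sK z; have [i Hi] := Hx (t * (k^-1 * z)).
  exists i; last first.
    exists (k * t^-1 * x i); first exact: (map_f (fun k => k * t^-1 * x i)).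
    by rewrite !invgM invgK -!mulgA.
  rewrite mem_filter mem_enum andbT; apply/negP => iF.
  have /asboolP := nP _ iF; apply.
  rewrite -[X in H i X](mulgK (k^-1 * z)) -[(x i)^-1 * t * _]mulgA.
  by apply: subgroupM => //; apply: subgroupV => //; apply: Kz.
rewrite mem_filter => /andP[/negP nF _] finHi; apply: nF.
by rewrite mem_filter mem_enum andbT; apply/asboolP.
Qed.

(** * Splitting remainders off a product of powers *)

Lemma prod_conj m (c : 'I_m -> G) : exists t : 'I_m -> G, forall u : 'I_m -> G,
  \prod_(i < m) (c i * u i) = (\prod_(i < m) c i) * \prod_(i < m) (u i ^ t i).
Proof.
elim: m c => [|m IHm] c; first by exists (fun=> 1) => u; rewrite !big_ord0 mulg1.
have [t tP] := IHm (fun i => c (lift ord0 i)).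
pose C := \prod_(i < m) c (lift ord0 i).
(* Each factor [u i] is conjugated by the product of the later [c j], so [t] depends on [c]
   alone. *)
exists (fun i => if unlift ord0 i is Some j then t j else C) => u.
rewrite !big_ord_recl tP unlift_none -/C.
under [in RHS]eq_bigr do rewrite liftK.
rewrite /= mulgA -(mulgA (c ord0) (u ord0)) (conjgC (u ord0)).
by rewrite (mulgA _ C) (mulgA (c ord0 * C) (_ ^ _)).
Qed.

(** Quantifying over [A] records that [h] is a power of [x ^+ e] in a form that applies directly to
    a preimage under conjugation. *)
Lemma expgz_modn e x (a : int) : (0 < e)%N ->
  exists (r : 'I_e) (h : G), expgz x a = x ^+ r * h /\
    forall A, subgroup A -> A (x ^+ e) -> A h.
Proof.
move=> e0.
have modnP n : exists (r : 'I_e) (h : G), x ^+ n = x ^+ r * h /\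
    forall A, subgroup A -> A (x ^+ e) -> A h.
  exists (Ordinal (ltn_pmod n e0)), ((x ^+ e) ^+ (n %/ e)); split=> /=.
    by rewrite -expgnA -expgnDr addnC mulnC -divn_eq.
  by move=> A sgA; apply: subgroupX.
case: a => [n|n]; first exact: modnP.
(* The exponent -(n + 1) is shifted by the multiple e (n + 1), which makes it nonnegative because e
   > 0. *)
have [r [h [rh hA]]] := modnP (e * n.+1 - n.+1)%N.
exists r, (h * ((x ^+ e) ^+ n.+1)^-1); split=> [|A sgA Ax]; last first.
  apply: subgroupM => //; first exact: hA.
  by apply: subgroupV => //; apply: subgroupX.
rewrite mulgA -rh -expgnA /=.
rewrite -[X in _ * (x ^+ X)^-1](@subnK n.+1 (e * n.+1)) ?leq_pmull //.
by rewrite [in X in _ * X]addnC expgnDr invgM mulgA mulgV mul1g.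
Qed.

End Cosets.

(** * Upper bounds for rank and index *)

Lemma card_le_Iexists (T : Type) (A : set T) n :
  (A #<= `I_n)%card -> exists2 k, (A #= `I_k)%card & (k <= n)%N.
Proof.
move=> An; have [k Ak] := card_le_finite An (finite_II n).
by exists k => //; rewrite -card_le_II -(card_le_eql Ak).
Qed.

Lemma least_le (P : set nat) k n : P k -> (k <= n)%N -> (least P <= (Posz n)%:E)%E.
Proof.
move=> Pk kn; rewrite /least; case: pselect => [exP|[]]; last first.
  by exists k; apply/mem_set.
case: ex_minnP => l _ lmin; rewrite lee_fin lez_nat.
by apply: leq_trans kn; apply/lmin/mem_set.
Qed.

(** Since [f] may repeat values, its range has some exact cardinality [k <= m], and this [k] is the
    one tested by [least]. *)
Lemma gen_rank_range (G : groupType) m (f : 'I_m -> G) :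
  (gen_rank (gen_subgroup (range f)) <= (Posz m)%:E)%E.
Proof.
have [k kP km] : exists2 k, (range f #= `I_k)%card & (k <= m)%N.
  apply: card_le_Iexists; apply: card_le_trans (card_image_le f setT) _.
  by have /card_eqPle[] := @card_II m.
by apply: least_le km; exists (range f).
Qed.

Lemma sg_index_le (G : groupType) (U : set G) (s : seq G) n :
  subgroup U -> coset_cover U s -> (size s <= n)%N ->
  (sg_index U <= (Posz n)%:E)%E.
Proof.
move=> sgU sU sn; pose f i := [set nth 1 s i * u | u in U].
have [k kP ks] : exists2 k, (left_cosets U #= `I_k)%card & (k <= size s)%N.
  apply: card_le_Iexists; apply: card_le_trans (card_image_le f `I_(size s)).
  apply: subset_card_le => _ [x _ <-]; have [y ys Uyx] := sU x.
  exists (index y s); first by rewrite /= index_mem.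
  rewrite /f nth_index //; apply/seteqP; split=> _ [u Uu <-].
    exists ((y^-1 * x)^-1 * u).
      by apply: subgroupM => //; apply: subgroupV.
    by rewrite invgM invgK !mulgA mulgV mul1g.
  exists (y^-1 * x * u); first exact: subgroupM.
  by rewrite !mulgA mulgV mul1g.
exact: least_le kP (leq_trans ks sn).
Qed.

Lemma expe_Posz (n m : nat) : ((Posz n)%:E ^+ m = (Posz (n ^ m))%:E)%E.
Proof.
rewrite -EFin_expe; congr (_%:E)%E.
by elim: m => // m IHm; rewrite GRing.exprS IHm expnS.
Qed.

Lemma expe_pinfty (m : nat) : (0 < m)%N -> ((+oo : \bar int) ^+ m = +oo)%E.
Proof.
case: m => // m _; elim: m => // m IHm.
by rewrite expeS IHm mulyy.
Qed.

Theorem lemma3p1 (m : nat) (m_gt0 : (0 < m)%N) (G : groupType)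
    (bgG : boundedly_generated G m) (L : set G) (sgL : subgroup L)
    (finL : (sg_index L < +oo)%E) :
  exists U : set G,
    [/\ subgroup U, U `<=` L, (gen_rank U <= (Posz m)%:E)%E
      & (sg_index U <= sg_exponent L ^+ m)%E].
Proof.
rewrite /sg_exponent /least; case: pselect => [exP|_]; last first.
  exists (gen_subgroup (range (fun _ : 'I_m => 1))); split.
  (* The exponent is finite since L has finite index, but this is not worth
     proving: for an infinite exponent the trivial subgroup would do. *)
  - exact: gen_subgroupP.
  - by apply: smallest_sub => // _ [_ _ <-]; apply: subgroup1.
  - exact: gen_rank_range.
  - by rewrite expe_pinfty // leey.
case: ex_minnP => e /set_mem[e_gt0 Le] _ {exP}.
have [g gP] := bgG.
(* The tuples of remainders form a finite type with [e ^ m] elements, the source of the index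
   bound. *)
pose c (r : {ffun 'I_m -> 'I_e}) (i : 'I_m) := g i ^+ r i.
have /choice[t tP] := fun r => prod_conj m (c r).
pose U r := gen_subgroup (range (fun i => (g i ^+ e) ^ t r i)).
have sgU r : subgroup (U r) by apply: gen_subgroupP.
have [z|r [s sN sU]] := cover_small_index _ U (fun r => \prod_(i < m) c r i) sgU.
  have [a ->] := gP z.
  have /choice[r /choice[h rh]] := fun i => expgz_modn e (g i) (a i) e_gt0.
  exists (finfun r).
  have -> : \prod_(i < m) expgz (g i) (a i) = \prod_(i < m) (c (finfun r) i * h i).
    by apply: eq_bigr => i _; rewrite /c ffunE; have [] := rh i.
  rewrite tP mulKg; apply: subgroup_prod => // i.
  (* The elements whose conjugate by [t (finfun r) i] lies in [U (finfun r)] form a subgroup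
     containing [g i ^+ e], hence also [h i]. *)
  have [_ hA] := rh i; apply: (hA _ (subgroup_preim_conj _ (t (finfun r) i) (sgU _))).
  by apply: sub_gen_smallest; exists i.
exists (U r); split=> //.
- by apply: smallest_sub => // _ [i _ <-]; rewrite conjXg; apply: Le.
- exact: gen_rank_range.
- rewrite expe_Posz; apply: sg_index_le sU _ => //.
  by rewrite card_ffun !card_ord in sN.
Qed.
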